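(* Let $\Gamma$ be a countable discrete group and let $\mu$ be an admissible lazy finitely supported probability measure on $\Gamma$. For every fixed $x,y\in\Gamma$, $$\lambda^{|x|}K(x,y\,|\,\lambda)\longrightarrow K_{\bar\mu}(x,y)\qquad\text{as }\lambda\to0 .$$
   Context: $e$ is the identity of $\Gamma$; $\mu$ is admissible if its support generates $\Gamma$ as a semigroup, lazy if $\mu(e)>0$. $P^n(x,y)=\mu^{*n}(x^{-1}y)$, $P^0(x,y)=\delta_{x,y}$. $R=(\limsup_nP^n(x,y)^{1/n})^{-1}$ (independent of $x,y$). For $0<\lambda<R$: $G(x,y\,|\,\lambda)=\sum_{n\ge0}\lambda^nP^n(x,y)$ and $K(x,y\,|\,\lambda)=G(x,y\,|\,\lambda)/G(e,y\,|\,\lambda)$. $|x|=\inf\{n\ge0:P^n(e,x)>0\}$. Elements $e,x,y$ are aligned in this order on a geodesic if $|y|=|x|+|x^{-1}y|$. The $0$-Martin kernel is $K_{\bar\mu}(x,y)=P^{|y|-|x|}(x,y)/P^{|y|}(e,y)$ if $e,x,y$ are aligned in this order on a geodesic, and $K_{\bar\mu}(x,y)=0$ otherwise. *)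

(* Defs.v *)
From mathcomp Require Import all_boot all_order all_algebra.
From mathcomp Require Import all_classical all_reals all_analysis.
Import Order.TTheory GRing.Theory Num.Theory.
Import numFieldNormedType.Exports.

Set Implicit Arguments.
Unset Strict Implicit.
Unset Printing Implicit Defensive.

Local Open Scope classical_set_scope.
Local Open Scope ring_scope.

(* Measures on the discrete group are given by their mass functions.  Sums
   [\sum_(g \in A) F g] are finitely supported sums: they are the usual sums
   when F has finite support in A, as is the case below for finitely supported
   mu. *)
Definition mass_support (R : realType) (Gam : groupType) (mu : Gam -> R) :
    set Gam :=
  [set g | mu g != 0].

Definition finitely_supported_probability (R : realType) (Gam : groupType)
    (mu : Gam -> R) : Prop :=
  [/\ forall g, 0 <= mu g,
      finite_set (mass_support mu)
    & \sum_(g \in [set: Gam]) mu g = 1].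

Definition semigroup_closed (Gam : groupType) (A : set Gam) : Prop :=
  forall g h, A g -> A h -> A (g * h)%g.

Definition admissible (R : realType) (Gam : groupType) (mu : Gam -> R) : Prop :=
  smallest (@semigroup_closed Gam) (mass_support mu) = [set: Gam].

Definition lazy (R : realType) (Gam : groupType) (mu : Gam -> R) : Prop :=
  0 < mu 1%g.

Definition convolution (R : realType) (Gam : groupType) (f g : Gam -> R) :
    Gam -> R :=
  fun x => \sum_(h \in [set: Gam]) f h * g (h^-1 * x)%g.

Fixpoint convolution_power (R : realType) (Gam : groupType) (mu : Gam -> R)
    (n : nat) : Gam -> R :=
  match n with
  | 0%N => fun g => (g == 1%g)%:R
  | m.+1 => convolution mu (convolution_power mu m)
  end.

Definition transition (R : realType) (Gam : groupType) (mu : Gam -> R)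
    (n : nat) (x y : Gam) : R :=
  convolution_power mu n (x^-1 * y)%g.

(* The series converges for 0 < lambda < r, where 1/r is the limsup of
   P^n(x,y)^(1/n); as P^n(x,y) <= 1 one has r >= 1, so this covers all small
   positive lambda, which is all that matters for limits at 0. *)
Definition green (R : realType) (Gam : groupType) (mu : Gam -> R)
    (x y : Gam) (lambda : R) : R :=
  limn (series (fun n => lambda ^+ n * transition mu n x y)).

Definition martin (R : realType) (Gam : groupType) (mu : Gam -> R)
    (x y : Gam) (lambda : R) : R :=
  green mu x y lambda / green mu 1%g y lambda.

(* The least n with P^n(e,x) > 0; such an n exists when mu is admissible, and
   the value 0 is used when there is none. *)
Definition word_length (R : realType) (Gam : groupType) (mu : Gam -> R)
    (x : Gam) : nat :=
  match pselect (exists n, 0 < transition mu n 1%g x) with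
  | left ex => ex_minn ex
  | right _ => 0%N
  end.

Definition aligned (R : realType) (Gam : groupType) (mu : Gam -> R)
    (x y : Gam) : bool :=
  (word_length mu y == word_length mu x + word_length mu (x^-1 * y)%g)%N.

Definition zero_martin (R : realType) (Gam : groupType) (mu : Gam -> R)
    (x y : Gam) : R :=
  if aligned mu x y then
    transition mu (word_length mu y - word_length mu x)%N x y
      / transition mu (word_length mu y) 1%g y
  else 0.

(* Main.v *)
Require Import Defs.
From mathcomp Require Import all_boot all_order all_algebra.
From mathcomp Require Import all_classical all_reals all_analysis.
From mathcomp Require Import ring lra.
Import Order.TTheory GRing.Theory Num.Theory.
Import numFieldNormedType.Exports.

Set Implicit Arguments.
Unset Strict Implicit.
Unset Printing Implicit Defensive.

Local Open Scope classical_set_scope.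
Local Open Scope ring_scope.

(** As [lambda] tends to 0, a power series is governed by its first nonzero
    term.  The series [G(x,y|lambda)] has coefficients [P^n(x,y)], which lie in
    [0,1] and vanish for n smaller than |x^-1 y|, so that
    [G(x,y|lambda) ~ lambda^|x^-1 y| P^|x^-1 y|(x,y)]; likewise
    [G(e,y|lambda) ~ lambda^|y| P^|y|(e,y)], where the coefficient is positive
    ([cvg_green_leading]).  Hence [lambda^|x| K(x,y|lambda)] is
    [lambda^(|x| + |x^-1 y| - |y|)] times a quantity converging to
    [P^|x^-1 y|(x,y) / P^|y|(e,y)].  The exponent is nonnegative by the triangle
    inequality ([word_length_triangle]), and it is zero exactly when e, x, y are
    aligned on a geodesic: then |x^-1 y| = |y| - |x| and the limit is the
    0-Martin kernel; otherwise the power of [lambda] drives the limit to 0.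

    The group enters only through positivity: a product of steps of positive
    probability has positive probability ([convolution_power_mul_gt0]).  Together
    with admissibility this makes every |x| a genuine minimum, and it gives the
    triangle inequality. *)

(** * Convolution powers of a finitely supported probability *)

(** Trades the sum over the whole group for one over a fixed list, where the
    order lemmas for iterated operators apply. *)
Lemma mass_fsbigE (R : realType) (Gam : groupType) (mu F : Gam -> R) :
  finite_set (mass_support mu) ->
  \sum_(h \in [set: Gam]) mu h * F h =
  \sum_(h <- finmap.enum_fset (fset_set (mass_support mu))) mu h * F h.
Proof.
move=> fmu; apply: fsbigTE => h.
rewrite in_fset_set// notin_setE => /negP; rewrite negbK => /eqP ->.
exact: mul0r.
Qed.

Lemma convolution_ge0 (R : realType) (Gam : groupType) (mu f : Gam -> R) :
  finitely_supported_probability mu -> (forall g, 0 <= f g) ->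
  forall g, 0 <= convolution mu f g.
Proof.
move=> [mu0 fmu _] f0 g; rewrite /convolution mass_fsbigE//.
by apply: sumr_ge0 => h _; rewrite mulr_ge0.
Qed.

Lemma convolution_le1 (R : realType) (Gam : groupType) (mu f : Gam -> R) :
  finitely_supported_probability mu -> (forall g, f g <= 1) ->
  forall g, convolution mu f g <= 1.
Proof.
move=> [mu0 fmu mu1] f1 g; rewrite /convolution mass_fsbigE//.
have <- : \sum_(h \in [set: Gam]) mu h * (fun=> 1) h = 1.
  by rewrite -[RHS]mu1; apply: eq_fsbigr => h _; rewrite mulr1.
rewrite mass_fsbigE//.
by apply: ler_sum => h _; rewrite ler_wpM2l.
Qed.

Lemma convolution_gt0P (R : realType) (Gam : groupType) (mu f : Gam -> R) :
  finitely_supported_probability mu -> (forall g, 0 <= f g) ->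
  forall g, 0 < convolution mu f g <->
    exists2 h, 0 < mu h & 0 < f (h^-1 * g)%g.
Proof.
move=> [mu0 fmu _] f0 g; rewrite /convolution mass_fsbigE//.
set s := finmap.enum_fset _; split=> [|[h muh fh]].
  rewrite lt_def psumr_neq0; last by move=> h _; rewrite mulr_ge0.
  move=> /andP[/hasP[h _ /= muf] _].
  move: muf; rewrite lt_def mulf_eq0 negb_or => /andP[/andP[muh fh] _].
  by exists h; rewrite lt_def ?muh ?fh ?mu0 ?f0.
have hs : h \in s.
  by rewrite in_fset_set// inE /mass_support/= gt_eqF.
rewrite (big_rem h hs) /= ltr_pwDl ?mulr_gt0//.
by apply: sumr_ge0 => k _; rewrite mulr_ge0.
Qed.

Lemma convolution_power_ge0 (R : realType) (Gam : groupType) (mu : Gam -> R) :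
  finitely_supported_probability mu ->
  forall n g, 0 <= convolution_power mu n g.
Proof.
by move=> mup; elim=> [|n IH] g /=; [exact: ler0n|exact: convolution_ge0].
Qed.

Lemma convolution_power_le1 (R : realType) (Gam : groupType) (mu : Gam -> R) :
  finitely_supported_probability mu ->
  forall n g, convolution_power mu n g <= 1.
Proof.
move=> mup; elim=> [|n IH] g /=; first by rewrite lern1 leq_b1.
exact: convolution_le1.
Qed.

(** A path from e to g followed by one from g to gh is a path from e to gh;
    the induction peels off the first step of the path to g. *)
Lemma convolution_power_mul_gt0 (R : realType) (Gam : groupType)
  (mu : Gam -> R) : finitely_supported_probability mu ->
  forall m n g h, 0 < convolution_power mu m g ->
    0 < convolution_power mu n h -> 0 < convolution_power mu (m + n) (g * h)%g.
Proof.
move=> mup; have cp0 := convolution_power_ge0 mup.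
elim=> [|m IH] n g h /=.
  by rewrite ltr0n lt0b => /eqP ->; rewrite mul1g.
move=> /(convolution_gt0P mup (cp0 m))[k muk gk] hh.
apply/(convolution_gt0P mup (cp0 _)); exists k => //.
by rewrite mulgA; exact: IH.
Qed.

(** The elements reached with positive probability form a semigroup containing
    the support. *)
Lemma admissible_reach (R : realType) (Gam : groupType) (mu : Gam -> R) :
  finitely_supported_probability mu -> admissible mu ->
  forall g, exists n, 0 < convolution_power mu n g.
Proof.
move=> mup adm g.
have : [set: Gam] g by [].
rewrite -adm; apply: (smallest_sub
  (X := [set a | exists n, 0 < convolution_power mu n a])) => [a b [m am] [n bn]|a /= mua].
  by exists (m + n)%N; exact: convolution_power_mul_gt0.
exists 1%N; apply/(convolution_gt0P mup (convolution_power_ge0 mup 0)).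
exists a; last by rewrite /= mulVg eqxx.
by have [mu0 _ _] := mup; rewrite lt_def mua mu0.
Qed.

(** * The word length *)

Lemma word_lengthP (R : realType) (Gam : groupType) (mu : Gam -> R) :
  finitely_supported_probability mu -> admissible mu -> forall g,
  0 < convolution_power mu (word_length mu g) g /\
  forall n, 0 < convolution_power mu n g -> (word_length mu g <= n)%N.
Proof.
move=> mup adm g.
have tE n : transition mu n 1%g g = convolution_power mu n g.
  by rewrite /transition invg1 mul1g.
rewrite /word_length; case: pselect => [ex|nex].
  case: ex_minnP => m mg mmin; split=> [|n ng]; first by rewrite -tE.
  by apply: mmin; rewrite tE.
case: nex; have [n ng] := admissible_reach mup adm g.
by exists n; rewrite tE.
Qed.

Lemma word_length_triangle (R : realType) (Gam : groupType) (mu : Gam -> R) :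
  finitely_supported_probability mu -> admissible mu -> forall x y,
  (word_length mu y <= word_length mu x + word_length mu (x^-1 * y)%g)%N.
Proof.
move=> mup adm x y; have wP := word_lengthP mup adm.
apply: (wP y).2; rewrite -[X in convolution_power _ _ X](mulVKg x).
by apply: convolution_power_mul_gt0 => //; exact: (wP _).1.
Qed.

(** * Power series at 0 *)

(** The terms of degree larger than m add up to at most the geometric tail
    [l^(m+1) / (1 - l)], which is at most [2 l^(m+1)] for [l <= 1/2]. *)
Lemma power_series_leading_bounds (R : realType) (a : nat -> R) (m : nat) :
  (forall n, 0 <= a n <= 1) -> (forall n, (n < m)%N -> a n = 0) ->
  forall l : R, 0 < l -> l <= 2^-1 ->
  l ^+ m * a m <= limn (series (fun n => l ^+ n * a n))
    <= l ^+ m * (a m + 2 * l).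
Proof.
move=> a01 am l l0 l2.
have a0 n : 0 <= a n by have /andP[] := a01 n.
have a1 n : a n <= 1 by have /andP[] := a01 n.
set u := series _.
have uS n : u n.+1 = u n + l ^+ n * a n.
  by rewrite /u /series /= big_nat_recr.
have u_nd : {homo u : n k / (n <= k)%N >-> n <= k}.
  by apply/nondecreasing_seqP => n; rewrite uS lerDl mulr_ge0// exprn_ge0 ?ltW.
have um : u m = 0.
  rewrite /u /series /= big_nat_cond big1// => i; rewrite andbT => /andP[_ im].
  by rewrite am ?mulr0.
(* The correction [2 l^(m+j+1)], a bound for the missing tail, makes the
   estimate stable under induction. *)
have u_tail j : u (m + j).+1 <= l ^+ m * (a m + 2 * l) - 2 * l ^+ (m + j).+1.
  elim: j => [|j IH].
    by rewrite addn0 uS um exprSr mulrDr add0r; lra.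
  rewrite addnS uS.
  have p0 : 0 <= l ^+ (m + j).+1 by rewrite exprn_ge0 ?ltW.
  have h1 : l ^+ (m + j).+1 * a (m + j).+1 <= l ^+ (m + j).+1.
    by rewrite ler_piMr.
  have h2 : l ^+ (m + j).+2 <= l ^+ (m + j).+1 * 2^-1.
    by rewrite (exprSr _ (m + j).+1) ler_wpM2l.
  lra.
have u_ub n : u n <= l ^+ m * (a m + 2 * l).
  apply: (le_trans (u_nd n (m + n).+1 _)); first by rewrite leqW// leq_addl.
  apply: (le_trans (u_tail n)).
  by rewrite gerBl mulr_ge0// exprn_ge0 ?ltW.
have u_cvg : cvgn u.
  apply: nondecreasing_is_cvgn => //.
  by exists (l ^+ m * (a m + 2 * l)) => _ [n _ <-].
apply/andP; split.
  by have := nondecreasing_cvgn_le u_nd u_cvg m.+1; rewrite uS um add0r.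
by apply: limr_le => //; apply: nearW.
Qed.

Lemma cvg_power_series_leading (R : realType) (a : nat -> R) (m : nat) :
  (forall n, 0 <= a n <= 1) -> (forall n, (n < m)%N -> a n = 0) ->
  limn (series (fun n => l ^+ n * a n)) / l ^+ m @[l --> 0^'+] --> a m.
Proof.
move=> a01 am.
apply: (@squeeze_cvgr _ _ _ _ (fun=> a m) (fun l => a m + 2 * l)).
- near=> l.
  have l0 : 0 < l by near: l; exact: nbhs_right_gt.
  have l2 : l <= 2^-1.
    by apply/ltW; near: l; apply: nbhs_right_lt; rewrite invr_gt0.
  rewrite ler_pdivlMr ?ler_pdivrMr ?exprn_gt0//.
  rewrite ![_ * l ^+ m]mulrC.
  exact: power_series_leading_bounds.
- exact: cvg_cst.
- apply: cvg_at_right_filter.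
  rewrite -[X in _ --> X]addr0 -[X in _ --> _ + X](mulr0 2).
  by apply: cvgD; [exact: cvg_cst|apply: cvgM; [exact: cvg_cst|exact: cvg_id]].
Unshelve. all: by end_near.
Qed.

(** * The Martin kernel at 0 *)

Lemma cvg_green_leading (R : realType) (Gam : groupType) (mu : Gam -> R) :
  finitely_supported_probability mu -> admissible mu -> forall x y,
  green mu x y l / l ^+ word_length mu (x^-1 * y)%g @[l --> 0^'+]
    --> transition mu (word_length mu (x^-1 * y)%g) x y.
Proof.
move=> mup adm x y.
apply: (@cvg_power_series_leading _ (fun n => transition mu n x y)) => n.
  by rewrite convolution_power_ge0 ?convolution_power_le1.
apply: contraTeq => n0; rewrite -leqNgt.
apply: (word_lengthP mup adm _).2.
by rewrite lt_def n0 convolution_power_ge0.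
Qed.

Theorem proposition4p2 (R : realType) (Gam : groupType)
  (countable_Gam : countable [set: Gam]) (mu : Gam -> R)
  (mu_prob : finitely_supported_probability mu)
  (mu_admissible : admissible mu) (mu_lazy : lazy mu) (x y : Gam) :
  lambda ^+ word_length mu x * martin mu x y lambda @[lambda --> 0^'+]
    --> zero_martin mu x y.
Proof.
have lead := cvg_green_leading mu_prob mu_admissible.
have tri := word_length_triangle mu_prob mu_admissible x y.
have den := lead 1%g y; rewrite invg1 mul1g in den.
have num := lead x y.
have den_gt0 : 0 < transition mu (word_length mu y) 1%g y.
  by rewrite /transition invg1 mul1g; exact: (word_lengthP mu_prob mu_admissible y).1.
rewrite /zero_martin /aligned.
set a := word_length mu x in tri *.
set b := word_length mu y in den den_gt0 tri *.
set c := word_length mu (x^-1 * y)%g in num tri *.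
pose ratio l := (green mu x y l / l ^+ c) / (green mu 1%g y l / l ^+ b).
have ratio_cvg : ratio l @[l --> 0^'+] -->
    transition mu c x y / transition mu b 1%g y.
  by apply: cvgM => //; apply: cvgV => //; rewrite gt_eqF.
have pow_cvg : l ^+ (a + c - b) @[l --> (0 : R)^'+] --> (0 : R) ^+ (a + c - b).
  by apply: cvg_at_right_filter; exact: exprn_continuous.
have factor : {near (0 : R)^'+,
    (fun l => l ^+ (a + c - b) * ratio l) =1
    (fun l => l ^+ a * martin mu x y l)}.
  near=> l; have l0 : 0 < l by near: l; exact: nbhs_right_gt.
  have lc : l ^+ c != 0 by rewrite expf_neq0 ?gt_eqF.
  have -> : l ^+ a = l ^+ (a + c - b) * l ^+ b * (l ^+ c)^-1.
    by rewrite -exprD subnK// exprD mulfK.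
  rewrite /ratio /martin invf_div.
  move: (green mu 1%g y l)^-1 (l ^+ c)^-1 (l ^+ (_ - _)) (l ^+ b) => G lc' p q.
  by ring.
apply: cvg_trans; first exact: near_eq_cvg factor.
have : l ^+ (a + c - b) * ratio l @[l --> (0 : R)^'+] -->
    (0 : R) ^+ (a + c - b) * (transition mu c x y / transition mu b 1%g y).
  exact: cvgM pow_cvg ratio_cvg.
rewrite expr0n subn_eq0.
have -> : (a + c <= b)%N = (b == a + c)%N by rewrite eqn_leq tri.
by case: eqP => [->|_]; rewrite /= ?mul0r// mul1r addKn.
Unshelve. all: by end_near.
Qed.
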